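(* Let $D=\sum_{i=1}^{d}a_i(\boldsymbol{x})\frac{\partial}{\partial x_i}$, where $\boldsymbol{x}=(x_1,\dots,x_d)\in\mathbb{R}^d$ and the $a_i(\boldsymbol{x})$ are differentiable scalar functions. For a given differentiable function $\phi(\boldsymbol{x})$ put $V=\dfrac{D^2\phi(\boldsymbol{x})}{D\phi(\boldsymbol{x})}$ and $$L_{n+1}=\prod_{j=0}^{n}\left[D+\left(j-\frac n2\right)V\right]=\left(D-\frac n2V\right)\cdot\ldots\cdot\left(D+\frac n2V\right).$$ Then the set of linearly-independent functions $$\{(D\phi(\boldsymbol{x}))^{-n/2}\phi^{k}(\boldsymbol{x}),\ k=0,1,2,\dots,n\}$$ forms a null function $$f_{n+1}(\boldsymbol{x})=[D\phi(\boldsymbol{x})]^{-n/2}\sum_{k=0}^{n}c_k\,\phi^{k}(\boldsymbol{x}),$$ where $\{c_k\}$ is a set of constants, such that $f_{n+1}(\boldsymbol{x})$ satisfies the equation $$L_{n+1}f_{n+1}(\boldsymbol{x})=0.$$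
   Context: Here $n\ge 0$ is an integer, and $n+1$ is the order of the differential operator $L_{n+1}$. The operator $D$ acts on a scalar function $g$ by $Dg=\sum_{i=1}^{d}a_i(\boldsymbol{x})\,\partial g/\partial x_i$, and $D^2\phi=D(D\phi)$. The function $V$ is called the generalized pre-Schwarzian of $\phi$ and acts by multiplication, so for a number $m$ the operator $D+mV$ sends $g$ to $Dg+mVg$. The product defining $L_{n+1}$ is an ordered composition of operators: the factor with $j=0$ is leftmost (applied last) and the factor with $j=n$ is rightmost (applied first). For $d=1$ and $a_1=1$ these operators are the classical Weiss operators. *)

(* Defs.v *)
From mathcomp Require Import all_boot all_order all_algebra complex.
From mathcomp Require Import all_classical all_reals all_analysis.
Set Implicit Arguments.
Unset Strict Implicit.
Unset Printing Implicit Defensive.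
Import Order.TTheory GRing.Theory Num.Theory.
Import numFieldNormedType.Exports.
Local Open Scope classical_set_scope.
Local Open Scope complex_scope.
Local Open Scope ring_scope.

(** The coefficients [a] and the function [phi] are real-valued.  The null
    functions, their constants [c_k] and the functions [L_{n+1}] acts on are
    complex-valued, since [(D phi)^{-n/2}] is not real where [D phi < 0] and
    [n] is odd. *)

(** Components of a vector field and functions are total; only their values on
    the open set [U] of the theorem matter. *)
Definition opD (R : realType) (d : nat) (a : 'I_d -> 'rV[R]_d -> R)
    (g : 'rV[R]_d -> R) : 'rV[R]_d -> R :=
  fun x => \sum_(i < d) a i x * 'D_(delta_mx 0 i) g x.

Definition opDC (R : realType) (d : nat) (a : 'I_d -> 'rV[R]_d -> R)
    (g : 'rV[R]_d -> R[i]) : 'rV[R]_d -> R[i] :=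
  fun x => opD a (fun y => complex.Re (g y)) x
        +i* opD a (fun y => complex.Im (g y)) x.

Definition differentiableC (R : realType) (d : nat)
    (g : 'rV[R]_d -> R[i]) (x : 'rV[R]_d) : Prop :=
  differentiable (fun y => complex.Re (g y)) x /\
  differentiable (fun y => complex.Im (g y)) x.

Definition preSchwarzian (R : realType) (d : nat) (a : 'I_d -> 'rV[R]_d -> R)
    (phi : 'rV[R]_d -> R) : 'rV[R]_d -> R :=
  fun x => opD a (opD a phi) x / opD a phi x.

(** The operator [D + m V]. *)
Definition DmV (R : realType) (d : nat) (a : 'I_d -> 'rV[R]_d -> R)
    (V : 'rV[R]_d -> R) (m : R) (g : 'rV[R]_d -> R[i]) : 'rV[R]_d -> R[i] :=
  fun x => opDC a g x + (m * V x)%:C * g x.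

(** The composition of the factors with indices [k <= j <= n], smallest index
    leftmost; it is the identity for [k = n.+1]. *)
Definition weiss_tail (R : realType) (d : nat) (a : 'I_d -> 'rV[R]_d -> R)
    (phi : 'rV[R]_d -> R) (n k : nat) :
    ('rV[R]_d -> R[i]) -> ('rV[R]_d -> R[i]) :=
  \big[comp/id]_(k <= j < n.+1)
     DmV a (preSchwarzian a phi) (j%:R - n%:R / 2).

(** [weiss a phi n] is [L_{n+1}]. *)
Definition weiss (R : realType) (d : nat) (a : 'I_d -> 'rV[R]_d -> R)
    (phi : 'rV[R]_d -> R) (n : nat) :
    ('rV[R]_d -> R[i]) -> ('rV[R]_d -> R[i]) :=
  weiss_tail a phi n 0.

(** [f] satisfies [L_{n+1} f = 0] on [U] in the classical sense.  ['D_v g x] has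
    a junk value where [g] has no derivative, so one must also ask that every
    function to which a factor of [L_{n+1}] is applied is differentiable. *)
Definition null_function (R : realType) (d : nat) (a : 'I_d -> 'rV[R]_d -> R)
    (phi : 'rV[R]_d -> R) (n : nat) (U : set 'rV[R]_d)
    (f : 'rV[R]_d -> R[i]) : Prop :=
  (forall k : nat, (0 < k <= n.+1)%N ->
     forall x, U x -> differentiableC (weiss_tail a phi n k f) x) /\
  (forall x, U x -> weiss a phi n f x = 0).

(** The principal value of [y ^ (- n / 2)] for a nonzero real [y]. *)
Definition half_powN (R : realType) (y : R) (n : nat) : R[i] :=
  sqrtC (y%:C) ^- n.

Definition lin_indep_on (R : realType) (T : Type) (U : set T) (m : nat)
    (e : 'I_m -> T -> R[i]) : Prop :=
  forall c : 'I_m -> R[i],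
    (forall x, U x -> \sum_(k < m) c k * e k x = 0) -> forall k, c k = 0.

(* Main.v *)
(** Write w = D phi.  For a polynomial p and m = n/2 - j,
      (D + m V) (w^(j - n/2) p(phi)) = w^(j + 1 - n/2) p'(phi),
    because the two terms in V cancel.  Hence applying the factors of L_{n+1}
    from right to left to w^(-n/2) p(phi) differentiates p once per factor, and
    n + 1 factors kill every p of degree at most n.
    Linear independence: if p(phi) = 0 on U, then applying D gives
    p'(phi) w = 0, so p'(phi) = 0 on U; by induction on the degree p' = 0, so p
    is a constant, and p = 0 since U is nonempty. *)
Require Import Defs.
From mathcomp Require Import all_boot all_order all_algebra complex.
From mathcomp Require Import all_classical all_reals all_analysis ring.
Set Implicit Arguments.
Unset Strict Implicit.
Unset Printing Implicit Defensive.
Import Order.TTheory GRing.Theory Num.Theory.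
Import numFieldNormedType.Exports.
Local Open Scope classical_set_scope.
Local Open Scope complex_scope.
Local Open Scope ring_scope.

(** The first-order expansion at [x] involves only values near [x], so that of [f] serves for [g],
    and uniqueness identifies the differentials. *)
Lemma near_eq_differentiable (R : realType) (V W : normedModType R)
    (f g : V -> W) (x : V) :
  (\near x, f x = g x) -> differentiable f x -> differentiable g x.
Proof.
move=> fg df; have [dfc dfx] := (diff_locallyP x f).1 df.
have fgx : f x = g x by exact: nbhs_singleton fg.
have dgx : g \o shift x = cst (g x) + 'd f x +o_ 0 id.
  apply/eqaddoP => _/posnumP[e].
  move/eqaddoP : dfx => /(_ e%:num) /(_ [gt0 of e%:num]).
  rewrite -fgx; apply: filter_app.
  have : \forall h \near (0 : V), f (h + x) = g (h + x).
    by move: fg; rewrite (near_shift 0 x) subr0.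
  by apply: filter_app; near=> h => fgh; rewrite /= !fctE /= fgh.
have dgf : 'd g x = 'd f x :> (V -> W) by exact: diff_unique.
by apply/diff_locallyP; rewrite dgf.
Unshelve. all: by end_near. Qed.

(** Differentiability is bundled with the value of D, so each rule below also yields the regularity
    that [null_function] demands. *)
Definition has_opD (R : realType) (d : nat) (a : 'I_d -> 'rV[R]_d -> R)
    (f : 'rV[R]_d -> R) (x : 'rV[R]_d) (l : R) : Prop :=
  differentiable f x /\ opD a f x = l.

Definition has_opDC (R : realType) (d : nat) (a : 'I_d -> 'rV[R]_d -> R)
    (f : 'rV[R]_d -> R[i]) (x : 'rV[R]_d) (l : R[i]) : Prop :=
  has_opD a (fun y => complex.Re (f y)) x (complex.Re l) /\
  has_opD a (fun y => complex.Im (f y)) x (complex.Im l).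

(** * Calculus rules for D on real and complex functions *)

Section Derivation.
Variables (R : realType) (d : nat) (a : 'I_d -> 'rV[R]_d -> R).
Variable x : 'rV[R]_d.
Implicit Types f g : 'rV[R]_d -> R.
Implicit Types F G : 'rV[R]_d -> R[i].

Lemma has_opDE f : differentiable f x -> has_opD a f x (opD a f x).
Proof. by []. Qed.

Lemma has_opD_cst c : has_opD a (cst c) x 0.
Proof.
split; first exact: differentiable_cst.
by rewrite /opD big1 // => i _; rewrite derive_cst mulr0.
Qed.

Lemma has_opDD f g l m : has_opD a f x l -> has_opD a g x m ->
  has_opD a (f + g) x (l + m).
Proof.
move=> [df <-] [dg <-]; split; first exact: differentiableD.
rewrite /opD -big_split; apply: eq_bigr => i _ /=.
by rewrite deriveD ?mulrDr //; exact: diff_derivable.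
Qed.

Lemma has_opDN f l : has_opD a f x l -> has_opD a (- f) x (- l).
Proof.
move=> [df <-]; split; first exact: differentiableN.
rewrite /opD -sumrN; apply: eq_bigr => i _ /=.
by rewrite deriveN ?mulrN //; exact: diff_derivable.
Qed.

Lemma has_opDM f g l m : has_opD a f x l -> has_opD a g x m ->
  has_opD a (f * g) x (l * g x + f x * m).
Proof.
move=> [df <-] [dg <-]; split; first exact: differentiableM.
rewrite /opD mulr_suml mulr_sumr -big_split; apply: eq_bigr => i _ /=.
rewrite deriveM; [|exact: diff_derivable..].
by rewrite /GRing.scale /= mulrDr addrC mulrCA -mulrA [g x * _]mulrC.
Qed.

Lemma has_opD_comp (h : R -> R) f l h' : has_opD a f x l ->
  is_derive (f x) 1 h h' -> has_opD a (h \o f) x (h' * l).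
Proof.
move=> [df <-] [/derivable1_diffP dh <-].
have dhf : differentiable (h \o f) x by exact: differentiable_comp.
split=> //; rewrite /opD mulr_sumr; apply: eq_bigr => i _ /=.
(* The inner differential is a real number, written as itself times 1 so that linearity of the
   differential of [h] pulls it out. *)
rewrite !deriveE // diff_comp //= -[in LHS](mulr1 ('d f x _)).
by rewrite -[_ * 1]/(_ *: 1) linearZ /= [RHS]mulrC -mulrA.
Qed.

Lemma near_eq_has_opD f g l : (\near x, f x = g x) ->
  has_opD a f x l -> has_opD a g x l.
Proof.
move=> fg [df <-]; split; first exact: near_eq_differentiable fg df.
by apply: eq_bigr => i _; congr (_ * _); apply/esym/near_eq_derive.
Qed.

Lemma has_opDC_cst c : has_opDC a (cst c) x 0.
Proof. by split; exact: has_opD_cst. Qed.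

Lemma has_opDC_real f l : has_opD a f x l ->
  has_opDC a (fun y => (f y)%:C) x l%:C.
Proof. by move=> fl; split => //; exact: has_opD_cst. Qed.

Lemma has_opDCE F l : has_opDC a F x l -> opDC a F x = l.
Proof. by case: l => l1 l2 [[_ /= <-] [_ /= <-]]. Qed.

Lemma has_opDCD F G l m : has_opDC a F x l -> has_opDC a G x m ->
  has_opDC a (fun y => F y + G y) x (l + m).
Proof.
move: l m => [l1 l2] [m1 m2] [F1 F2] [G1 G2]; split=> /=.
- rewrite (_ : (fun _ => _) = (fun y => complex.Re (F y)) +
      (fun y => complex.Re (G y))); first exact: has_opDD.
  by apply/funext => y; rewrite fctE; case: (F y) (G y) => [? ?] [].
- rewrite (_ : (fun _ => _) = (fun y => complex.Im (F y)) +
      (fun y => complex.Im (G y))); first exact: has_opDD.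
  by apply/funext => y; rewrite fctE; case: (F y) (G y) => [? ?] [].
Qed.

Lemma has_opDCM F G l m : has_opDC a F x l -> has_opDC a G x m ->
  has_opDC a (fun y => F y * G y) x (l * G x + F x * m).
Proof.
move: l m => [l1 l2] [m1 m2] [F1 F2] [G1 G2]; split=> /=.
- rewrite (_ : (fun _ => _) =
      (fun y => complex.Re (F y)) * (fun y => complex.Re (G y)) +
      - ((fun y => complex.Im (F y)) * (fun y => complex.Im (G y)))).
    rewrite [complex.Re _](_ : _ =
      (l1 * complex.Re (G x) + complex.Re (F x) * m1) +
      - (l2 * complex.Im (G x) + complex.Im (F x) * m2)).
      by apply: has_opDD; [|apply: has_opDN]; exact: has_opDM.
    by case: (F x) (G x) => [? ?] [? ?] /=; ring.
  by apply/funext => y; rewrite !fctE; case: (F y) (G y) => [? ?] [].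
- rewrite (_ : (fun _ => _) =
      (fun y => complex.Re (F y)) * (fun y => complex.Im (G y)) +
      (fun y => complex.Im (F y)) * (fun y => complex.Re (G y))).
    rewrite [complex.Im _](_ : _ =
      (l1 * complex.Im (G x) + complex.Re (F x) * m2) +
      (l2 * complex.Re (G x) + complex.Im (F x) * m1)).
      by apply: has_opDD; exact: has_opDM.
    by case: (F x) (G x) => [? ?] [? ?] /=; ring.
  by apply/funext => y; rewrite !fctE; case: (F y) (G y) => [? ?] [].
Qed.

Lemma near_eq_has_opDC F G l : (\near x, F x = G x) ->
  has_opDC a F x l -> has_opDC a G x l.
Proof.
move=> FG [F1 F2]; split.
- apply: near_eq_has_opD F1; move: FG; apply: filter_app.
  by near=> y => ->.
- apply: near_eq_has_opD F2; move: FG; apply: filter_app.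
  by near=> y => ->.
Unshelve. all: by end_near. Qed.

(** Horner recursion [p * 'X + c] reduces this chain rule to the sum and product rules, without any
    complex differentiation. *)
Lemma has_opDC_horner (p : {poly R[i]}) f l : has_opD a f x l ->
  has_opDC a (fun y => p.[(f y)%:C]) x (p^`().[(f x)%:C] * l%:C).
Proof.
move=> fl; elim/poly_ind: p => [|p c IH].
  rewrite deriv0 horner0 mul0r.
  rewrite (_ : (fun _ => _) = cst 0); first exact: has_opDC_cst.
  by apply/funext => y; rewrite horner0.
rewrite (_ : (fun _ => _) = (fun y => p.[(f y)%:C] * (f y)%:C + c)); last first.
  by apply/funext => y; rewrite !hornerE.
rewrite [X in has_opDC _ _ _ X](_ : _ = (p^`().[(f x)%:C] * l%:C * (f x)%:C +
   p.[(f x)%:C] * l%:C) + 0).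
  apply: has_opDCD; last exact: has_opDC_cst.
  by apply: has_opDCM => //; exact: has_opDC_real.
by rewrite derivD derivC derivM derivX !hornerE; ring.
Qed.

End Derivation.

(** * The half-integer power and its derivative *)

(** The square root is multiplicative once one factor is a nonnegative real. The complex factor
    depends only on the sign of [y], so only a real function is left to differentiate. *)
Lemma half_powN_polar (R : realType) (y : R) (n : nat) :
  half_powN y n =
  ((Num.sqrt `|y| ^+ n)^-1)%:C * sqrtC ((Num.sg y)%:C : R[i]) ^- n.
Proof.
rewrite /half_powN {1}[y]numEsg mulrC rmorphM rootCMl ?ler0c //.
rewrite -{1}(sqr_sqrtr (normr_ge0 y)) rmorphXn sqrCK ?ler0c ?sqrtr_ge0 //.
by rewrite exprMn invfM fmorphV rmorphXn.
Qed.

Lemma half_powN_neq0 (R : realType) (y : R) (n : nat) :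
  y != 0 -> half_powN y n != 0.
Proof.
move=> y0; rewrite /half_powN invr_neq0 // expf_neq0 // rootC_eq0 //.
by rewrite -[0]/(0%:C) (inj_eq (@complexI _)).
Qed.

(** With [s] the sign of [t], this is the derivative of [|t|^(-n/2)]. *)
Lemma is_derive_sqrtXV (R : realType) (s t : R) (n : nat) :
  s ^+ 2 = 1 -> 0 < s * t ->
  is_derive t 1 (fun u => (Num.sqrt (s * u) ^+ n)^-1)
    (- (n%:R / 2) / t * (Num.sqrt (s * t) ^+ n)^-1).
Proof.
move=> s2 st; set q := Num.sqrt (s * t).
have q0 : q != 0 by rewrite gt_eqF // sqrtr_gt0.
have q2 : q ^+ 2 = s * t by rewrite sqr_sqrtr // ltW.
have ds : is_derive t 1 ( *%R s) s.
  by apply: is_derive_eq; rewrite /GRing.scale /= mulr1.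
have dq := is_derive1_comp (is_derive1_sqrt st) ds.
have dX := is_deriveX n dq.
have qn0 : ((Num.sqrt \o *%R s) ^+ n) t != 0 by rewrite exprfctE expf_neq0.
rewrite (_ : (fun u => _) =
    (fun u => (((Num.sqrt \o *%R s) ^+ n) u)^-1)); last first.
  by apply/funext => u; rewrite exprfctE.
apply: (is_derive_eq (is_deriveV qn0 dX)).
rewrite exprfctE /= -/q /GRing.scale /=.
have s0 : s != 0 by rewrite -sqrf_eq0 s2 oner_eq0.
(* Eliminating [t], and then [s^-1], leaves a rational identity in [s] and [q]; the case split on
   [n] resolves the exponent [n.-1] of the differentiated power. *)
have -> : t = s * q ^+ 2 by rewrite q2 mulrA -expr2 s2 mul1r.
have sV : s^-1 = s by apply: (mulfI s0); rewrite divff // -expr2 s2.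
rewrite [(s * _)^-1]invfM sV; case: n {dX qn0} => [|m].
  by rewrite !(mul0r, mulr0, oppr0).
have qm0 := expf_neq0 m q0.
by rewrite !exprS /=; field; rewrite q0 qm0.
Qed.

(** By continuity [w] keeps its sign near [x]; there the polar form is a real power of [s * w] times
    the constant [K]. *)
Lemma has_opDC_half_powN (R : realType) (d n : nat)
    (a : 'I_d -> 'rV[R]_d -> R) (w : 'rV[R]_d -> R) (x : 'rV[R]_d) (l : R) :
  w x != 0 -> has_opD a w x l ->
  has_opDC a (fun y => half_powN (w y) n) x
    ((- (n%:R / 2) / w x * l)%:C * half_powN (w x) n).
Proof.
move=> w0 wl; set s := Num.sg (w x).
have s2 : s ^+ 2 = 1 by rewrite sqr_sg w0.
have sw : s * w x = `|w x| by rewrite [in RHS]normrEsg.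
have sw0 : 0 < s * w x by rewrite sw normr_gt0.
have sg_near : \near x, s * w x > 0.
  have cw : {for x, continuous w} by apply: differentiable_continuous; case: wl.
  have cs : (fun y => s * w y) @ x --> s * w x.
    by apply: cvgM cw; exact: cvg_cst.
  exact: cvgr_gt cs _ sw0.
pose K : R[i] := sqrtC (s%:C) ^- n.
have E y : 0 < s * w y ->
    half_powN (w y) n = ((Num.sqrt (s * w y) ^+ n)^-1)%:C * K.
  move=> swy; have sy : Num.sg (w y) = s.
    have : Num.sg (s * w y) = 1 by rewrite gtr0_sg.
    rewrite sgrM /s sgr_id -/s => h.
    by rewrite -[LHS]mul1r -s2 expr2 -mulrA h mulr1.
  by rewrite half_powN_polar sy [ `|w y|]normrEsg sy.
apply: (@near_eq_has_opDC _ _ _ _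
  (fun y => ((Num.sqrt (s * w y) ^+ n)^-1)%:C * K)).
  by apply: filter_app sg_near; near=> y => /E.
rewrite E // mulrA -rmorphM /=.
rewrite [X in has_opDC _ _ _ X](_ : _ =
  (- (n%:R / 2) / w x * (Num.sqrt (s * w x) ^+ n)^-1 * l)%:C * K +
  ((Num.sqrt (s * w x) ^+ n)^-1)%:C * 0); last first.
  by rewrite mulr0 addr0 [in LHS]mulrAC.
apply: (has_opDCM (G := cst K)); last exact: has_opDC_cst.
apply: (has_opDC_real (f := (fun u => (Num.sqrt (s * u) ^+ n)^-1) \o w)).
exact/has_opD_comp/is_derive_sqrtXV.
Unshelve. all: by end_near. Qed.

(** * Action of the Weiss factors, and independence of the powers of phi *)

Section Weiss.
Variables (R : realType) (d n : nat) (U : set 'rV[R]_d).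
Variables (a : 'I_d -> 'rV[R]_d -> R) (phi : 'rV[R]_d -> R).
Hypothesis U_open : open U.
Hypothesis phi_diff : forall x, U x -> differentiable phi x.
Hypothesis Dphi_diff : forall x, U x -> differentiable (opD a phi) x.
Hypothesis Dphi_neq0 : forall x, U x -> opD a phi x != 0.

(** The function [(D phi)^(j - n/2) p(phi)]. *)
Let ansatz (j : nat) (p : {poly R[i]}) (x : 'rV[R]_d) : R[i] :=
  half_powN (opD a phi x) n * (opD a phi x)%:C ^+ j * p.[(phi x)%:C].

(** Since D w = V w for w = D phi, differentiating the power of w gives the V term; D p(phi) =
    p'(phi) w raises that power by one. *)
Lemma has_opDC_ansatz (j : nat) (p : {poly R[i]}) (x : 'rV[R]_d) : U x ->
  has_opDC a (ansatz j p) x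
    (((j%:R - n%:R / 2) * preSchwarzian a phi x)%:C * ansatz j p x +
     ansatz j.+1 p^`() x).
Proof.
move=> Ux; have w0 := Dphi_neq0 Ux.
have hphi := has_opDE a (phi_diff Ux).
have hw := has_opDE a (Dphi_diff Ux).
have := has_opDCM (has_opDCM (has_opDC_half_powN n w0 hw)
  (has_opDC_horner 'X^j hw)) (has_opDC_horner p hphi).
rewrite (_ : (fun _ => _) = ansatz j p); last first.
  by apply/funext => y; rewrite /ansatz hornerXn.
congr has_opDC.
rewrite /ansatz /preSchwarzian derivXn hornerMn !hornerXn.
have wC : (opD a phi x)%:C != 0 by rewrite -[0]/(0%:C) (inj_eq (@complexI _)).
set w := opD a phi x in w0 wC *; set l := opD a _ x.
rewrite !(rmorphM, rmorphB, rmorphN, fmorphV, rmorph_nat) /=.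
(* The derivative of ['X^j] carries the exponent [j.-1], hence the separate case [j = 0]. *)
by case: j => [|j]; last rewrite !exprS -mulr_natr; field; exact: wC.
Qed.

Lemma eq_has_opDC_ansatz (F : 'rV[R]_d -> R[i]) (j : nat) (p : {poly R[i]})
    (x : 'rV[R]_d) :
  (forall y, U y -> F y = ansatz j p y) -> U x ->
  has_opDC a F x
    (((j%:R - n%:R / 2) * preSchwarzian a phi x)%:C * ansatz j p x +
     ansatz j.+1 p^`() x).
Proof.
move=> FE Ux; apply: near_eq_has_opDC (has_opDC_ansatz _ _ Ux).
have : nbhs x U by exact: open_nbhs_nbhs.
by apply: filter_app; near=> y => Uy; rewrite FE.
Unshelve. all: by end_near. Qed.

(** Induction on the number [j] of factors already applied from the right; these are the ones with
    index at least [n.+1 - j]. *)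
Lemma weiss_tail_ansatz (p : {poly R[i]}) (f : 'rV[R]_d -> R[i]) (j : nat) :
  (forall x, U x -> f x = ansatz 0 p x) -> (j <= n.+1)%N ->
  forall x, U x -> weiss_tail a phi n (n.+1 - j) f x = ansatz j p^`(j) x.
Proof.
move=> fE; elim: j => [|j IH] jn x Ux.
  by rewrite subn0 /weiss_tail big_geq //= fE.
rewrite subSS /weiss_tail big_ltn ?ltnS ?leq_subr //= -subSn //.
rewrite -/(weiss_tail _ _ _ _).
have IHx := IH (ltnW jn).
have D_tail := eq_has_opDC_ansatz IHx Ux.
(* The new factor has index [n - j], and its coefficient n - j - n/2 is the opposite of j - n/2, so
   the V terms cancel. *)
rewrite /DmV (has_opDCE D_tail) IHx // natrB //.
move: (preSchwarzian a phi x) => V.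
rewrite !(rmorphM, rmorphB, rmorph_nat, fmorphV) /=.
by field.
Qed.

Lemma horner_phi_eq0 (p : {poly R[i]}) : U !=set0 ->
  (forall x, U x -> p.[(phi x)%:C] = 0) -> p = 0.
Proof.
move=> [x0 Ux0]; elim: (size p) {-2}p (leqnn (size p)) => {p}[|m IH] p pm p0.
  by apply/eqP; rewrite -size_poly_leq0.
have p'0 : p^`() = 0.
  have [->|pN0] := eqVneq p 0; first by rewrite deriv0.
  apply: IH => [|x Ux]; first by rewrite -ltnS (leq_trans (lt_size_deriv pN0)).
  (* As [U] is open, p(phi) agrees with 0 near [x], so the chain rule computes D of the zero
     function. *)
  have /has_opDCE : has_opDC a (cst 0) x
      (p^`().[(phi x)%:C] * (opD a phi x)%:C).
    apply: near_eq_has_opDC (has_opDC_horner p (has_opDE a (phi_diff Ux))).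
    have : nbhs x U by exact: open_nbhs_nbhs.
    by apply: filter_app; near=> y => Uy; rewrite p0.
  rewrite (has_opDCE (has_opDC_cst a x 0)) => /esym/eqP; rewrite mulf_eq0 orbC.
  by rewrite -[0]/(0%:C) (inj_eq (@complexI _)) (negbTE (Dphi_neq0 Ux)) => /eqP.
(* In characteristic 0, a vanishing derivative kills every coefficient of positive index. *)
have pC : p = (p`_0)%:P.
  apply/polyP => -[|i]; rewrite coefC //=.
  have /eqP := congr1 (fun q : {poly R[i]} => q`_i) p'0.
  by rewrite coef_deriv coef0 mulrn_eq0 => /eqP.
by move: (p0 _ Ux0); rewrite pC hornerC => ->.
Unshelve. all: by end_near. Qed.

End Weiss.


Theorem theorem2p1 (R : realType) (d n : nat) (U : set 'rV[R]_d)
    (a : 'I_d -> 'rV[R]_d -> R) (phi : 'rV[R]_d -> R)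
    (U_open : open U) (U_neq0 : U !=set0)
    (a_diff : forall i x, U x -> differentiable (a i) x)
    (phi_diff : forall x, U x -> differentiable phi x)
    (Dphi_diff : forall x, U x -> differentiable (opD a phi) x)
    (Dphi_neq0 : forall x, U x -> opD a phi x != 0) :
  lin_indep_on U
    (fun (k : 'I_n.+1) x => half_powN (opD a phi x) n * (phi x)%:C ^+ k) /\
  (forall c : 'I_n.+1 -> R[i],
    null_function a phi n U
      (fun x => half_powN (opD a phi x) n *
                \sum_(k < n.+1) c k * (phi x)%:C ^+ k)).
Proof.
(* [inord] extends the family [c] to natural-number indices, as [\poly] expects. *)
have sum_horner c y : \sum_(k < n.+1) c k * y ^+ k =
    (\poly_(k < n.+1) c (inord k)).[y] :> R[i].
  by rewrite horner_poly; apply: eq_bigr => k _; rewrite inord_val.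
split=> [c c0 k|c].
  pose p := \poly_(k < n.+1) c (inord k).
  have p0 : p = 0.
    apply: (horner_phi_eq0 U_open phi_diff Dphi_neq0 U_neq0) => x Ux.
    apply: (mulfI (half_powN_neq0 n (Dphi_neq0 x Ux))).
    rewrite mulr0 -sum_horner mulr_sumr -[RHS](c0 x Ux).
    by apply: eq_bigr => i _; rewrite mulrCA.
  have := congr1 (fun q : {poly R[i]} => q`_k) p0.
  by rewrite coef_poly ltn_ord inord_val coef0.
set f := fun x => _.
set p := \poly_(k < n.+1) c (inord k).
have fE y : U y -> f y = half_powN (opD a phi y) n * (opD a phi y)%:C ^+ 0 *
    p.[(phi y)%:C] by rewrite /f expr0 mulr1 sum_horner.
have tailE := weiss_tail_ansatz U_open phi_diff Dphi_diff Dphi_neq0 fE.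
split=> [k /andP[k0 kn] x Ux|x Ux].
  (* The tail from index [k] is reached after [n.+1 - k] factors; the derivative rule for the ansatz
     there includes differentiability. *)
  rewrite -(subKn kn).
  by have [[? _] [? _]] := eq_has_opDC_ansatz U_open phi_diff Dphi_diff
    Dphi_neq0 (tailE _ (leq_subr k n.+1)) Ux.
(* All [n.+1] factors have been applied, and [p] has size at most [n.+1]. *)
rewrite /weiss -(subnn n.+1) tailE // derivn_poly0 ?size_poly //.
by rewrite horner0 mulr0.
Qed.
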